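(* Let $G:G_1\overset{d_G}{\longrightarrow}G_0$ and $H:H_1\overset{d_H}{\longrightarrow}H_0$ be two isoclinic crossed modules. (i) $G$ is nilpotent if and only if $H$ is nilpotent, and $G$ is solvable if and only if $H$ is solvable. (ii) If $G$ and $H$ are nilpotent (respectively solvable) and both nontrivial, then they have the same nilpotency class (respectively the same derived length).
   Context: A crossed module $G:G_1\overset{d_G}{\longrightarrow}G_0$ is a group homomorphism $d_G:G_1\to G_0$ together with a left action of $G_0$ on $G_1$ by automorphisms, written ${}^{g_0}g_1$, such that $d_G({}^{g_0}g_1)=g_0d_G(g_1)g_0^{-1}$ and ${}^{d_G(g_1)}g_1'=g_1g_1'g_1^{-1}$. The trivial crossed module is $1\to1$. A morphism from $G$ to $G':G_1'\overset{d'}{\longrightarrow}G_0'$ is a pair $(\alpha,\beta)$ of group homomorphisms $\alpha:G_1\to G_1'$, $\beta:G_0\to G_0'$ with $\beta d_G=d'\alpha$ and $\alpha({}^{g_0}g_1)={}^{\beta(g_0)}\alpha(g_1)$; it is an isomorphism if both components are bijective. A subcrossed module $K:K_1\to K_0$ of $G$ consists of subgroups $K_1\le G_1$, $K_0\le G_0$ forming a crossed module under the restricted boundary map and action; it is normal ($K\trianglelefteq G$) if $K_0$ is normal in $G_0$, ${}^{g_0}k_1\in K_1$ and ${}^{k_0}g_1g_1^{-1}\in K_1$ for all $g_i\in G_i$, $k_i\in K_i$; then $G/K:G_1/K_1\to G_0/K_0$ is the quotient crossed module. Put $G_1^{G_0}=\{g_1\in G_1:{}^{g_0}g_1=g_1\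 \forall g_0\in G_0\}$, $St_{G_0}(G_1)=\{g_0\in G_0:{}^{g_0}g_1=g_1\ \forall g_1\in G_1\}$, and let $D_{G_0}(G_1)$ be the subgroup of $G_1$ generated by all ${}^{g_0}g_1g_1^{-1}$. The center of $G$ is $Z(G):G_1^{G_0}\to St_{G_0}(G_1)\cap Z(G_0)$ and the commutator subcrossed module is $[G,G]:D_{G_0}(G_1)\to[G_0,G_0]$ (maps and actions restricted from $G$). $G$ is Abelian if $G=Z(G)$. Write $\overline{G_1}=G_1/G_1^{G_0}$, $\overline{G_0}=G_0/(St_{G_0}(G_1)\cap Z(G_0))$, so $G/Z(G)$ is $\overline{G_1}\to\overline{G_0}$. There are well-defined maps $c_1^G:\overline{G_1}\times\overline{G_0}\to D_{G_0}(G_1)$, $(\overline{g_1},\overline{g_0})\mapsto{}^{g_0}g_1g_1^{-1}$, and $c_0^G:\overline{G_0}\times\overline{G_0}\to[G_0,G_0]$, $(\overline{g_0},\overline{g_0'})\mapsto[g_0,g_0']=g_0g_0'g_0^{-1}g_0'^{-1}$. Crossed modules $G$ and $H$ are isoclinic if there exist crossed module isomorphisms $(\eta_1,\eta_0):G/Z(G)\to H/Z(H)$ and $(\xi_1,\xi_0):[G,G]\to[H,H]$ such that $\xi_1\circ c_1^G=c_1^H\circ(\eta_1\times\eta_0)$ and $\xi_0\circ c_0^G=c_0^H\circ(\eta_0\times\eta_0)$. A series of $G$ is a finite chain of subcrossed modules $1=K^0\trianglelefteq K^1\trianglelefteq\dots\trianglelefteq K^n=G$. $G$ is solvable if it has a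 series all of whose factors $K^i/K^{i-1}$ are Abelian; it is nilpotent if it has a series all of whose factors are central factors of $G$, i.e. each $K^{i-1}$ is normal in $G$ and $K^i/K^{i-1}$ is contained in $Z(G/K^{i-1})$. The nilpotency class of a nilpotent $G$ is the least integer $c$ with $\Gamma_{c+1}(G)=1$, where $\Gamma_1(G)=G$ and $\Gamma_n(G)=[\Gamma_{n-1}(G),G]$ for $n>1$; here for a normal subcrossed module $K$ of $G$, $[K,G]$ is the subcrossed module with top group the subgroup of $G_1$ generated by all ${}^{k_0}g_1g_1^{-1}$ and all ${}^{g_0}k_1k_1^{-1}$ ($g_i\in G_i$, $k_i\in K_i$) and bottom group $[K_0,G_0]$. The derived length of a solvable $G$ is the least integer $n$ with $G^n=1$, where $G^0=G$ and $G^n=[G^{n-1},G^{n-1}]$ for $n>0$. *)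

(* Defs.v *)
From HB Require Import structures.
From mathcomp Require Import all_boot.
From mathcomp Require Import boolp.

Set Implicit Arguments.
Unset Strict Implicit.
Unset Printing Implicit Defensive.

Local Open Scope group_scope.
Local Open Scope quotient_scope.

(* Groups are MathComp's possibly infinite [groupType]s, and [groupClosed G]  *)
(* is the type of subgroups of [G].  Since [boolp] makes every proposition    *)
(* boolean and every type a choiceType, boolean membership and the choiceType *)
(* structure inside [groupType] are no restriction.                           *)

Definition mk_subgroup (G : groupType) (S : {pred G}) (gS : group_closed S) :
    groupClosed G :=
  HB.pack_for (groupClosed G) S
    (isMulClosed.Build G S (group_closedM gS))
    (isMul1Closed.Build G S gS.1)
    (isInvClosed.Build G S (group_closedV gS)).

Section Subgroups.
Variable G : groupType.
Implicit Types (S N : groupClosed G) (x y z : G).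

Lemma subgroup_closed S : group_closed S.
Proof. by split=> [|x y Sx Sy]; rewrite ?gpred1 ?gpredF. Qed.

Definition subgroup_type S := {x : G | x \in S}.
HB.instance Definition _ S := SubChoice.on (subgroup_type S).
HB.instance Definition _ S := SubChoice_isSubGroup.Build G (mem S)
  (subgroup_type S) (subgroup_closed S).

Fact full_group_closed : group_closed (predT : {pred G}).
Proof. by []. Qed.
Definition full_subgroup := mk_subgroup full_group_closed.

Definition generated_pred (A : G -> Prop) : {pred G} := fun x =>
  `[< forall S : groupClosed G, (forall a, A a -> a \in S) -> x \in S >].

Fact generated_group_closed A : group_closed (generated_pred A).
Proof.
split=> [|x y /asboolP Ax /asboolP Ay]; apply/asboolP => S AS.
  exact: gpred1.
by rewrite gpredF ?Ax ?Ay.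
Qed.
Definition generated A := mk_subgroup (generated_group_closed A).

Lemma mem_generated (A : G -> Prop) x : A x -> x \in generated A.
Proof. by move=> Ax; apply/asboolP => S; apply. Qed.

Lemma generated_sub (A : G -> Prop) S :
  (forall a, A a -> a \in S) -> forall x, x \in generated A -> x \in S.
Proof. by move=> AS x /asboolP; apply. Qed.

Fact preimage_closed (H : groupType) (f : G -> H) (S : groupClosed H) :
  {morph f : x y / x * y} -> group_closed (fun x => f x \in S).
Proof.
move=> fM; have f1 : f 1 = 1 by apply: (mulgI (f 1)); rewrite -fM !mulg1.
have fV x : f x^-1 = (f x)^-1.
  by apply: (mulgI (f x)); rewrite -fM !mulgV.
split=> [|x y Sx Sy]; first by change (f 1 \in S); rewrite f1 gpred1.
by change (f (x / y) \in S); rewrite fM fV gpredF.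
Qed.

Lemma generated_morph (H : groupType) (f : G -> H) (S : groupClosed H) A :
  {morph f : x y / x * y} -> (forall a, A a -> f a \in S) ->
  forall x, x \in generated A -> f x \in S.
Proof.
by move=> fM AS x /(generated_sub (S := mk_subgroup (preimage_closed S fM)) AS).
Qed.

(* The library's [~ x, y] is x^-1 y^-1 x y. *)
Definition comm x y := x * y * x^-1 * y^-1.

Definition commutator (S N : groupClosed G) : groupClosed G :=
  generated (fun z => exists x y, [/\ x \in S, y \in N & z = comm x y]).

Definition normal N := forall g n, n \in N -> g * n * g^-1 \in N.

Definition coset_rel N : rel G := fun x y => x^-1 * y \in N.

Fact coset_rel_refl N : reflexive (coset_rel N).
Proof. by move=> x; rewrite /coset_rel mulVg gpred1. Qed.

Fact coset_rel_sym N : symmetric (coset_rel N).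
Proof. by move=> x y; rewrite /coset_rel -gpredV invgM invgK. Qed.

Fact coset_rel_trans N : transitive (coset_rel N).
Proof.
move=> y x z; rewrite /coset_rel => xy yz.
by have := gpredM _ _ xy yz; rewrite -mulgA mulVKg.
Qed.

Canonical coset_equiv N :=
  EquivRel (coset_rel N) (@coset_rel_refl N) (@coset_rel_sym N)
    (@coset_rel_trans N).

Lemma group_center_closed :
  group_closed (fun z => `[< forall x, z * x = x * z >] : bool).
Proof.
split=> [|y z /asboolP cy /asboolP cz]; apply/asboolP => x.
  by rewrite mul1g mulg1.
apply: (mulIg z); rewrite -[RHS]mulgA mulgVK.
by rewrite -mulgA -cz -mulgA mulKg cy.
Qed.
Definition group_center := mk_subgroup group_center_closed.

End Subgroups.

Definition quotient_group (G : groupType) (N : groupClosed G) (nN : normal N) :=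
  {eq_quot (coset_equiv N)}.

Section QuotientGroup.
Variables (G : groupType) (N : groupClosed G) (nN : normal N).
Local Notation Q := (quotient_group nN).

HB.instance Definition _ := Choice.on Q.
HB.instance Definition _ := EqQuotient.on Q.

Implicit Types (x y z : G) (q : Q).

Lemma coset_eqP x y : reflect (x = y %[mod Q]) (x^-1 * y \in N).
Proof. exact: (@eqmodP _ (coset_equiv N) x y). Qed.

Lemma coset_repr x : (repr (\pi_Q x))^-1 * x \in N.
Proof. by apply/coset_eqP; rewrite reprK. Qed.

Lemma coset_ind (P : Q -> Prop) : (forall x, P (\pi_Q x)) -> forall q, P q.
Proof. by move=> Px q; rewrite -[q]reprK. Qed.

Definition qmul q q' : Q := \pi_Q (repr q * repr q').
Definition qone : Q := \pi_Q 1.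
Definition qinv q : Q := \pi_Q (repr q)^-1.

Lemma normalV (g n : G) : n \in N -> g^-1 * n * g \in N.
Proof. by move=> /(nN g^-1); rewrite invgK. Qed.

Lemma qmulE x y : qmul (\pi_Q x) (\pi_Q y) = \pi_Q (x * y).
Proof.
apply/coset_eqP; set a := repr _; set b := repr _.
have -> : (a * b)^-1 * (x * y) = b^-1 * (a^-1 * x) * b * (b^-1 * y).
  by rewrite invgM -!mulgA mulVKg.
by rewrite gpredM ?normalV ?coset_repr.
Qed.

Lemma qinvE x : qinv (\pi_Q x) = \pi_Q x^-1.
Proof.
apply/coset_eqP; rewrite invgK; set a := repr _.
have -> : a * x^-1 = a * (a^-1 * x)^-1 * a^-1.
  by rewrite invgM invgK mulgA mulgK.
by rewrite nN // gpredV coset_repr.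
Qed.

Fact qmulA : associative qmul.
Proof.
by elim/coset_ind=> x; elim/coset_ind=> y; elim/coset_ind=> z; rewrite !qmulE mulgA.
Qed.
Fact qmul1 : left_id qone qmul.
Proof. by elim/coset_ind=> x; rewrite qmulE mul1g. Qed.
Fact qmulr1 : right_id qone qmul.
Proof. by elim/coset_ind=> x; rewrite qmulE mulg1. Qed.
Fact qmulV : left_inverse qone qinv qmul.
Proof. by elim/coset_ind=> x; rewrite qinvE qmulE mulVg. Qed.
Fact qmulrV : right_inverse qone qinv qmul.
Proof. by elim/coset_ind=> x; rewrite qinvE qmulE mulgV. Qed.

HB.instance Definition _ := isGroup.Build Q qmulA qmul1 qmulr1 qmulV qmulrV.

Lemma coset_piM : {morph \pi_Q : x y / x * y}.
Proof. by move=> x y; rewrite -qmulE. Qed.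

End QuotientGroup.

Record crossed_module := CrossedModule {
  top : groupType;
  bot : groupType;
  bd : {multiplicative top -> bot};
  act : bot -> top -> top;
  act1 : forall x, act 1 x = x;
  actA : forall g h x, act (g * h) x = act g (act h x);
  actM : forall g x y, act g (x * y) = act g x * act g y;
  bd_act : forall g x, bd (act g x) = g * bd x * g^-1;
  peiffer : forall x y, act (bd x) y = x * y * x^-1
}.

Section ActionFacts.
Variable G : crossed_module.
Implicit Types (g h : bot G) (x y : top G).

Lemma act_1 g : act g 1 = 1 :> top G.
Proof. by apply: (mulgI (act g 1)); rewrite -actM !mulg1. Qed.

Lemma actV g x : act g x^-1 = (act g x)^-1.
Proof. by apply: (mulgI (act g x)); rewrite -actM !mulgV act_1. Qed.

Lemma actK g x : act g^-1 (act g x) = x.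
Proof. by rewrite -actA mulVg act1. Qed.

Lemma actKV g x : act g (act g^-1 x) = x.
Proof. by rewrite -actA mulgV act1. Qed.

Lemma bd1 : bd G 1 = 1.
Proof. by apply: (mulgI (bd G 1)); rewrite -gmulfM !mulg1. Qed.

Lemma bdV x : bd G x^-1 = (bd G x)^-1.
Proof. by apply: (mulgI (bd G x)); rewrite -gmulfM !mulgV bd1. Qed.

End ActionFacts.

Definition trivial (G : crossed_module) : Prop :=
  (forall x : top G, x = 1) /\ (forall g : bot G, g = 1).

Record xmorphism (G H : crossed_module) := XMorphism {
  xtop : {multiplicative top G -> top H};
  xbot : {multiplicative bot G -> bot H};
  xmor_bd : forall x, xbot (bd G x) = bd H (xtop x);
  xmor_act : forall g x, xtop (act g x) = act (xbot g) (xtop x)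
}.

Definition isomorphism (G H : crossed_module) (f : xmorphism G H) : Prop :=
  bijective (xtop f) /\ bijective (xbot f).

Record subxmod (G : crossed_module) := Subxmod {
  stop : groupClosed (top G);
  sbot : groupClosed (bot G);
  sbdP : forall x, x \in stop -> bd G x \in sbot;
  sactP : forall g x, g \in sbot -> x \in stop -> act g x \in stop
}.

Section SubCrossedModule.
Variables (G : crossed_module) (K : subxmod G).
Local Notation K1 := (subgroup_type (stop K)).
Local Notation K0 := (subgroup_type (sbot K)).

Definition sub_bd (x : K1) : K0 := Sub (bd G (val x)) (sbdP (valP x)).
Definition sub_act (g : K0) (x : K1) : K1 :=
  Sub (act (val g) (val x)) (sactP (valP g) (valP x)).

Fact sub_bdM : {morph sub_bd : x y / x * y}.
Proof. by move=> x y; apply: val_inj; rewrite /= gmulfM. Qed.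
HB.instance Definition _ := isMultiplicative.Build K1 K0 sub_bd sub_bdM.

Fact sub_act1 x : sub_act 1 x = x.
Proof. by apply: val_inj; rewrite /= act1. Qed.
Fact sub_actA g h x : sub_act (g * h) x = sub_act g (sub_act h x).
Proof. by apply: val_inj; rewrite /= actA. Qed.
Fact sub_actM g x y : sub_act g (x * y) = sub_act g x * sub_act g y.
Proof. by apply: val_inj; rewrite /= actM. Qed.
Fact sub_bd_act g x : sub_bd (sub_act g x) = g * sub_bd x * g^-1.
Proof. by apply: val_inj; rewrite /= bd_act. Qed.
Fact sub_peiffer x y : sub_act (sub_bd x) y = x * y * x^-1.
Proof. by apply: val_inj; rewrite /= peiffer. Qed.

Definition sub_crossed_module : crossed_module :=
  CrossedModule sub_act1 sub_actA sub_actM sub_bd_act sub_peiffer.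

End SubCrossedModule.

Coercion sub_crossed_module : subxmod >-> crossed_module.

Definition xsubset (G : crossed_module) (K L : subxmod G) : Prop :=
  {subset stop K <= stop L} /\ {subset sbot K <= sbot L}.

Definition full (G : crossed_module) : subxmod G :=
  @Subxmod G (full_subgroup (top G)) (full_subgroup (bot G))
    (fun _ _ => isT) (fun _ _ _ _ => isT).

Definition xnormal (G : crossed_module) (K : subxmod G) : Prop :=
  [/\ normal (sbot K),
      (forall (g : bot G) k, k \in stop K -> act g k \in stop K)
    & (forall k (x : top G), k \in sbot K -> act k x * x^-1 \in stop K)].

Record nsubxmod (G : crossed_module) := NSubxmod {
  nsub :> subxmod G;
  nsubP : xnormal nsub
}.

Section QuotientCrossedModule.
Variables (G : crossed_module) (K : nsubxmod G).

Lemma stop_normal : normal (stop K).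
Proof. by case: (nsubP K) => _ + _ x k Kk => /(_ (bd G x) k Kk); rewrite peiffer. Qed.

Lemma sbot_normal : normal (sbot K).
Proof. by case: (nsubP K). Qed.

Local Notation Q1 := (quotient_group stop_normal).
Local Notation Q0 := (quotient_group sbot_normal).

Definition quo_bd (x : Q1) : Q0 := \pi_Q0 (bd G (repr x)).
Definition quo_act (g : Q0) (x : Q1) : Q1 := \pi_Q1 (act (repr g) (repr x)).

Lemma quo_bdE x : quo_bd (\pi_Q1 x) = \pi_Q0 (bd G x).
Proof.
by apply/coset_eqP; rewrite -bdV -gmulfM; apply: sbdP; apply: coset_repr.
Qed.

Lemma quo_actE g x : quo_act (\pi_Q0 g) (\pi_Q1 x) = \pi_Q1 (act g x).
Proof.
have [nK0 K_act K_disp] := nsubP K.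
apply/coset_eqP; set h := repr _; set y := repr _; rewrite -actV.
have -> : g = h * (h^-1 * g) by rewrite mulVKg.
have Kk : h^-1 * g \in sbot K by apply: coset_repr.
move: (h^-1 * g) Kk => k Kk; rewrite actA -actM; apply: K_act.
have -> : y^-1 * act k x = y^-1 * (act k x * x^-1) * y * (y^-1 * x).
  by rewrite -!mulgA mulVKg mulVg mulg1.
rewrite gpredM ?coset_repr //.
by apply: normalV; [exact: stop_normal | exact: K_disp].
Qed.

Fact quo_bdM : {morph quo_bd : x y / x * y}.
Proof.
elim/coset_ind=> x; elim/coset_ind=> y.
by rewrite -coset_piM !quo_bdE gmulfM coset_piM.
Qed.
HB.instance Definition _ := isMultiplicative.Build Q1 Q0 quo_bd quo_bdM.

Fact quo_act1 x : quo_act 1 x = x.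
Proof. by elim/coset_ind: x => x; rewrite quo_actE act1. Qed.
Fact quo_actA g h x : quo_act (g * h) x = quo_act g (quo_act h x).
Proof.
elim/coset_ind: g => g; elim/coset_ind: h => h; elim/coset_ind: x => x.
by rewrite -coset_piM !quo_actE actA.
Qed.
Fact quo_actM g x y : quo_act g (x * y) = quo_act g x * quo_act g y.
Proof.
elim/coset_ind: g => g; elim/coset_ind: x => x; elim/coset_ind: y => y.
by rewrite -coset_piM !quo_actE actM coset_piM.
Qed.
Fact quo_bd_act g x : quo_bd (quo_act g x) = g * quo_bd x * g^-1.
Proof.
elim/coset_ind: g => g; elim/coset_ind: x => x.
by rewrite quo_actE !quo_bdE bd_act !coset_piM -(qinvE sbot_normal).
Qed.
Fact quo_peiffer x y : quo_act (quo_bd x) y = x * y * x^-1.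
Proof.
elim/coset_ind: x => x; elim/coset_ind: y => y.
by rewrite quo_bdE quo_actE peiffer !coset_piM -(qinvE stop_normal).
Qed.

Definition quotient : crossed_module :=
  CrossedModule quo_act1 quo_actA quo_actM quo_bd_act quo_peiffer.

Definition proj_top (x : top G) : top quotient := \pi_Q1 x.
Definition proj_bot (g : bot G) : bot quotient := \pi_Q0 g.

Lemma proj_topM : {morph proj_top : x y / x * y}.
Proof. exact: coset_piM. Qed.
Lemma proj_botM : {morph proj_bot : x y / x * y}.
Proof. exact: coset_piM. Qed.

Section Image.
Variable L : subxmod G.

Definition image_top_pred : {pred top quotient} :=
  fun q => `[< exists2 x, x \in stop L & q = proj_top x >].
Definition image_bot_pred : {pred bot quotient} :=
  fun q => `[< exists2 g, g \in sbot L & q = proj_bot g >].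

Fact image_top_closed : group_closed image_top_pred.
Proof.
split=> [|_ _ /asboolP[x Lx ->] /asboolP[y Ly ->]]; apply/asboolP.
  by exists 1; rewrite ?gpred1.
by exists (x / y); rewrite ?gpredF // proj_topM; congr (_ * _); exact: qinvE.
Qed.

Fact image_bot_closed : group_closed image_bot_pred.
Proof.
split=> [|_ _ /asboolP[x Lx ->] /asboolP[y Ly ->]]; apply/asboolP.
  by exists 1; rewrite ?gpred1.
by exists (x / y); rewrite ?gpredF // proj_botM; congr (_ * _); exact: qinvE.
Qed.

Fact image_bdP q : q \in mk_subgroup image_top_closed ->
  bd quotient q \in mk_subgroup image_bot_closed.
Proof.
move=> /asboolP[x Lx ->]; apply/asboolP.
by exists (bd G x); [exact: sbdP | exact: quo_bdE].
Qed.

Fact image_actP (h : bot quotient) q : h \in mk_subgroup image_bot_closed ->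
  q \in mk_subgroup image_top_closed -> act h q \in mk_subgroup image_top_closed.
Proof.
move=> /asboolP[g Lg ->] /asboolP[x Lx ->]; apply/asboolP.
by exists (act g x); [exact: sactP | exact: quo_actE].
Qed.

(* The image L K / K of L in G / K. *)
Definition image_quotient : subxmod quotient := Subxmod image_bdP image_actP.

End Image.
End QuotientCrossedModule.

Section Center.
Variable G : crossed_module.

Definition fixed_pred : {pred top G} :=
  fun x => `[< forall g : bot G, act g x = x >].
Fact fixed_closed : group_closed fixed_pred.
Proof.
split=> [|x y /asboolP fx /asboolP fy]; apply/asboolP=> g; first exact: act_1.
by rewrite actM actV fx fy.
Qed.
Definition fixed_points := mk_subgroup fixed_closed.

Definition stabilizer_pred : {pred bot G} :=
  fun g => `[< forall x : top G, act g x = x >].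
Fact stabilizer_closed : group_closed stabilizer_pred.
Proof.
split=> [|g h /asboolP sg /asboolP sh]; apply/asboolP=> x; first exact: act1.
by rewrite actA -{1}[x]sh actK sg.
Qed.
Definition stabilizer := mk_subgroup stabilizer_closed.

Fact center_bot_closed :
  group_closed [predI stabilizer & group_center (bot G)].
Proof.
split=> [|g h /andP[sg cg] /andP[sh ch]]; apply/andP; first by rewrite !gpred1.
by rewrite !gpredF.
Qed.
Definition center_bot := mk_subgroup center_bot_closed.

Fact center_bdP x : x \in fixed_points -> bd G x \in center_bot.
Proof.
move=> /asboolP fx; apply/andP; split.
  apply/asboolP=> y; have := fx (bd G y); rewrite !peiffer => fxy.
  by rewrite -{1}fxy mulgVK mulgK.
by apply/asboolP=> h; have := bd_act h x; rewrite fx => {1}->; rewrite mulgVK.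
Qed.

Fact center_actP g x :
  g \in center_bot -> x \in fixed_points -> act g x \in fixed_points.
Proof. by move=> _ fx; move: (fx) => /asboolP ->. Qed.

Definition center_subxmod : subxmod G := Subxmod center_bdP center_actP.

Fact center_normal : xnormal center_subxmod.
Proof.
split=> [g k kZ|g k fk|k x /andP[/asboolP sk _]].
- by move: (kZ) => /andP[_ /asboolP ck]; rewrite -ck mulgK.
- by move: (fk) => /asboolP ->.
- by rewrite sk mulgV gpred1.
Qed.

Definition xcenter : nsubxmod G := NSubxmod center_normal.

End Center.

Definition xabelian (G : crossed_module) : Prop := xsubset (full G) (xcenter G).

Section Commutator.
Variable G : crossed_module.
Implicit Types (g h : bot G) (x y : top G).

Definition displacement (g : bot G) (x : top G) := act g x * x^-1.

Lemma act_displacement g h x :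
  act g (displacement h x) = displacement (g * h * g^-1) (act g x).
Proof. by rewrite /displacement actM actV 2!actA actK. Qed.

Lemma bd_displacement g x : bd G (displacement g x) = comm g (bd G x).
Proof. by rewrite /displacement gmulfM bd_act bdV. Qed.

Definition comm_top :=
  generated (fun z => exists g x, z = displacement g x).
Definition comm_bot := commutator (full_subgroup (bot G)) (full_subgroup (bot G)).

Fact comm_bdP x : x \in comm_top -> bd G x \in comm_bot.
Proof.
apply: generated_morph; first exact: gmulfM.
move=> _ [g [y ->]]; rewrite bd_displacement; apply: mem_generated.
by exists g, (bd G y).
Qed.

Fact comm_actP g x : g \in comm_bot -> x \in comm_top -> act g x \in comm_top.
Proof.
move=> _; apply: generated_morph; first exact: actM.
move=> _ [h [y ->]]; rewrite act_displacement; apply: mem_generated.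
by exists (g * h * g^-1), (act g y).
Qed.

Definition xcommutator : subxmod G := Subxmod comm_bdP comm_actP.

Section Relative.
Variable K : nsubxmod G.

Definition rcomm_gen (z : top G) : Prop :=
  (exists k x, k \in sbot K /\ z = displacement k x) \/
  (exists g k, k \in stop K /\ z = displacement g k).

Definition rcomm_top := generated rcomm_gen.
Definition rcomm_bot := commutator (sbot K) (full_subgroup (bot G)).

Fact rcomm_top_act g x : x \in rcomm_top -> act g x \in rcomm_top.
Proof.
have [nK0 K_act _] := nsubP K.
apply: generated_morph; first exact: actM.
move=> _ [[k [y [Kk ->]]]|[h [k [Kk ->]]]]; rewrite act_displacement;
  apply: mem_generated; [left|right].
- by exists (g * k * g^-1), (act g y); split=> //; exact: nK0.
- by exists (g * h * g^-1), (act g k); split=> //; exact: K_act.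
Qed.

Fact rcomm_bdP x : x \in rcomm_top -> bd G x \in rcomm_bot.
Proof.
apply: generated_morph; first exact: gmulfM.
move=> _ [[k [y [Kk ->]]]|[h [k [Kk ->]]]]; rewrite bd_displacement.
  by apply: mem_generated; exists k, (bd G y).
rewrite -gpredV; apply: mem_generated.
exists (bd G k), h; split=> //; first exact: sbdP.
by rewrite /comm !invgM !invgK !mulgA.
Qed.

Fact rcomm_actP g x : g \in rcomm_bot -> x \in rcomm_top -> act g x \in rcomm_top.
Proof. by move=> _; exact: rcomm_top_act. Qed.

Definition rcomm_subxmod : subxmod G := Subxmod rcomm_bdP rcomm_actP.

Fact rcomm_normal : xnormal rcomm_subxmod.
Proof.
have [nK0 _ _] := nsubP K.
split=> [g|g x|k x Rk]; last 2 first.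
- exact: rcomm_top_act.
- apply: mem_generated; left; exists k, x; split=> //.
  move: k Rk; apply: generated_sub => _ [k [h [Kk _ ->]]].
  by rewrite /comm -!mulgA gpredM // mulgA nK0 // gpredV.
apply: (generated_morph (f := fun n => g * n * g^-1)).
  by move=> h k; rewrite -!mulgA mulKg.
move=> _ [k [h [Kk _ ->]]]; apply: mem_generated.
exists (g * k * g^-1), (g * h * g^-1); split=> //; first exact: nK0.
by rewrite /comm !invgM !invgK -!mulgA !mulKg.
Qed.

Definition xcomm : nsubxmod G := NSubxmod rcomm_normal.

End Relative.

Fact full_normal : xnormal (full G).
Proof. by []. Qed.

(* lower_central n is the term Gamma_n for n >= 1 (Gamma_0 := Gamma_1). *)
Definition lower_central (n : nat) : nsubxmod G :=
  iter n.-1 xcomm (NSubxmod full_normal).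

End Commutator.

Definition derived (G : crossed_module) (n : nat) : crossed_module :=
  iter n (fun X => sub_crossed_module (xcommutator X)) G.

Section CommutatorMaps.
Variable G : crossed_module.
Local Notation GZ := (quotient (xcenter G)).

Fact c1_subproof (x : top GZ) (g : bot GZ) :
  displacement (repr g) (repr x) \in comm_top G.
Proof. by apply: mem_generated; exists (repr g), (repr x). Qed.

Definition c1 (x : top GZ) (g : bot GZ) : top (xcommutator G) :=
  Sub (displacement (repr g) (repr x)) (c1_subproof x g).

Fact c0_subproof (g h : bot GZ) : comm (repr g) (repr h) \in comm_bot G.
Proof. by apply: mem_generated; exists (repr g), (repr h). Qed.

Definition c0 (g h : bot GZ) : bot (xcommutator G) :=
  Sub (comm (repr g) (repr h)) (c0_subproof g h).

(* c1 and c0 do not depend on the chosen representatives. *)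
Lemma c1E x g :
  val (c1 (proj_top (xcenter G) x) (proj_bot (xcenter G) g)) = displacement g x.
Proof.
rewrite /c1 SubK /displacement; set h := repr _; set y := repr _.
have /andP[/asboolP Zs _] : h^-1 * g \in center_bot G by apply: coset_repr.
have /asboolP fy : y^-1 * x \in fixed_points G by apply: coset_repr.
rewrite -[g](mulVKg h) -[x](mulVKg y) actA Zs actM fy.
by rewrite -[x in RHS](mulVKg y) invgM mulgA mulgK.
Qed.

Lemma c0E g h :
  val (c0 (proj_bot (xcenter G) g) (proj_bot (xcenter G) h)) = comm g h.
Proof.
rewrite /c0 SubK /comm; set g' := repr _; set h' := repr _.
have /andP[_ /asboolP gZ] : g'^-1 * g \in center_bot G by apply: coset_repr.
have /andP[_ /asboolP hZ] : h'^-1 * h \in center_bot G by apply: coset_repr.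
rewrite -[g](mulVKg g') -[h](mulVKg h').
move: (g'^-1 * g) (h'^-1 * h) gZ hZ => z w cz cw.
have -> : g' * z * (h' * w) * (g' * z)^-1 = g' * (h' * w) * g'^-1.
  by rewrite -(mulgA g') cz invgM !mulgA mulgK.
by rewrite (mulgA g' h') -(mulgA (g' * h') w) cw invgM !mulgA mulgK.
Qed.

End CommutatorMaps.

Definition isoclinic (G H : crossed_module) : Prop :=
  exists (eta : xmorphism (quotient (xcenter G)) (quotient (xcenter H)))
         (xi : xmorphism (xcommutator G) (xcommutator H)),
  [/\ isomorphism eta, isomorphism xi,
      (forall x g, xtop xi (c1 x g) = c1 (xtop eta x) (xbot eta g))
    & (forall g h, xbot xi (c0 g h) = c0 (xbot eta g) (xbot eta h))].

(* The subcrossed module K :&: L of L; it is K itself when K is contained in  *)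
(* L.                                                                         *)
Section Restriction.
Variables (G : crossed_module) (K L : subxmod G).

Fact restrict_top_closed :
  group_closed (fun x : top L => val x \in stop K).
Proof. exact: preimage_closed. Qed.
Fact restrict_bot_closed :
  group_closed (fun g : bot L => val g \in sbot K).
Proof. exact: preimage_closed. Qed.

Definition restrict : subxmod L :=
  @Subxmod L (mk_subgroup restrict_top_closed) (mk_subgroup restrict_bot_closed)
    (fun x Kx => @sbdP G K (val x) Kx)
    (fun g x Kg Kx => @sactP G K (val g) (val x) Kg Kx).

End Restriction.

Record series (G : crossed_module) := Series {
  len : nat;
  term : nat -> subxmod G;
  term_first : trivial (term 0);
  term_last : xsubset (full G) (term len);
  term_sub : forall i, i < len -> xsubset (term i) (term i.+1);
  term_normal : forall i, i < len -> xnormal (restrict (term i) (term i.+1))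
}.

Definition factor (G : crossed_module) (s : series G) (i : 'I_(len s)) :
    crossed_module :=
  quotient (NSubxmod (term_normal (ltn_ord i))).

Definition solvable (G : crossed_module) : Prop :=
  exists s : series G, forall i : 'I_(len s), xabelian (factor i).

(* L / K is a central factor of G. *)
Definition central_factor (G : crossed_module) (L K : subxmod G) : Prop :=
  exists nK : xnormal K,
    xsubset (image_quotient (NSubxmod nK) L) (xcenter (quotient (NSubxmod nK))).

Definition nilpotent (G : crossed_module) : Prop :=
  exists s : series G,
    forall i : 'I_(len s), central_factor (term s i.+1) (term s i).

Definition nilpotency_class (G : crossed_module) (c : nat) : Prop :=
  trivial (lower_central G c.+1) /\
  forall m, trivial (lower_central G m.+1) -> (c <= m)%N.

Definition derived_length (G : crossed_module) (n : nat) : Prop :=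
  trivial (derived G n) /\ forall m, trivial (derived G m) -> (n <= m)%N.

(* Main.v *)
Require Import Defs.
From mathcomp Require Import all_boot.
From HB Require Import structures.
From mathcomp Require Import boolp.

(** The argument is the classical one for groups: isoclinic objects have a
    common cover in which nothing is lost from the commutator.

    Let E be the fibre product of G and H over the common central quotient
    G/Z(G) = H/Z(H), that is, the pairs of elements matched by eta.  Both
    projections from E are onto.  A displacement or a commutator of pairs has
    its components matched by xi, by the compatibility of (eta, xi) with the
    commutator maps, so [E,E] lies in the graph of xi; since xi is bijective,
    each projection is injective on [E,E] (isoclinic_common_cover).

    A surjective morphism maps every commutator construction onto the
    corresponding one, hence Gamma_n onto Gamma_n and the n-th derived term onto
    the n-th derived term.  Beyond the first step these terms lie in the
    commutator, where the projections of E are injective, so such a term is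
    trivial in E exactly when it is trivial in G, and likewise for H
    (trivial_lower_central_image, trivial_derived_image).  The first terms, G
    and H themselves, are both nontrivial in part (ii), so the triviality of
    the terms agrees at every index and the least indices coincide.

    It remains to know that G is nilpotent exactly when some Gamma_n is trivial
    (nilpotentP), and solvable exactly when some derived term is trivial
    (solvableP): a central, or Abelian, series read from the top dominates the
    lower central, or derived, series term by term, and conversely these series
    themselves serve as witnesses. *)

Set Implicit Arguments.
Unset Strict Implicit.
Unset Printing Implicit Defensive.

Local Open Scope group_scope.
Local Open Scope quotient_scope.

(** * Images of commutator constructions *)

Section Multiplicative.
Variables (G H : groupType) (f : {multiplicative G -> H}).

Lemma multiplicative1 : f 1 = 1.
Proof. by apply: (mulgI (f 1)); rewrite -gmulfM !mulg1. Qed.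

Lemma multiplicativeV x : f x^-1 = (f x)^-1.
Proof. by apply: (mulgI (f x)); rewrite -gmulfM !mulgV multiplicative1. Qed.

Lemma multiplicative_comm x y : f (comm x y) = comm (f x) (f y).
Proof. by rewrite /comm !gmulfM !multiplicativeV. Qed.

End Multiplicative.

Section MapsOnto.
Variables G H : groupType.

Definition maps_onto (f : G -> H) (S : groupClosed G) (T : groupClosed H) :=
  (forall x, x \in S -> f x \in T) /\
  (forall y, y \in T -> exists2 x, x \in S & f x = y).

Lemma maps_onto_generated (f : {multiplicative G -> H}) (A : G -> Prop)
    (B : H -> Prop) :
  (forall a, A a -> B (f a)) -> (forall b, B b -> exists2 a, A a & f a = b) ->
  maps_onto f (generated A) (generated B).
Proof.
move=> AB BA; split.
  apply: generated_morph; first exact: gmulfM.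
  by move=> a /AB; apply: mem_generated.
pose I : {pred H} := fun y => `[< exists2 x, x \in generated A & f x = y >].
have gI : group_closed I.
  split=> [|_ _ /asboolP[x Ax <-] /asboolP[y Ay <-]]; apply/asboolP.
    by exists 1; rewrite ?gpred1 // multiplicative1.
  by exists (x / y); rewrite ?gpredF // gmulfM multiplicativeV.
move=> y /(generated_sub (S := mk_subgroup gI)) Iy; apply/asboolP; apply: Iy.
move=> b /BA[a Aa fa]; apply/asboolP; exists a => //; exact: mem_generated.
Qed.

Lemma maps_onto_commutator (f : {multiplicative G -> H}) S S' T T' :
  maps_onto f S T -> maps_onto f S' T' ->
  maps_onto f (commutator S S') (commutator T T').
Proof.
move=> [ST TS] [ST' TS']; apply: maps_onto_generated.
  by move=> _ [x [y [Sx Sy ->]]]; exists (f x), (f y); rewrite multiplicative_comm; split; auto.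
move=> _ [x' [y' [/TS[x Sx <-] /TS'[y Sy <-] ->]]].
by exists (comm x y); [exists x, y | rewrite multiplicative_comm].
Qed.

End MapsOnto.

Lemma maps_onto_comp (G H L : groupType) (g : H -> L) (f : G -> H) R S T :
  maps_onto f R S -> maps_onto g S T -> maps_onto (g \o f) R T.
Proof.
move=> [RS SR] [ST TS]; split=> [x /RS/ST //|_ /TS[y /SR[x Rx <-] <-]].
by exists x.
Qed.

Section Morphisms.
Variables G H L : crossed_module.

Fact xcomp_bd (g : xmorphism H L) (f : xmorphism G H) x :
  (xbot g \o xbot f) (bd G x) = bd L ((xtop g \o xtop f) x).
Proof. by rewrite /= !xmor_bd. Qed.

Fact xcomp_act (g : xmorphism H L) (f : xmorphism G H) (h : bot G) (x : top G) :
  (xtop g \o xtop f) (act h x) = act ((xbot g \o xbot f) h) ((xtop g \o xtop f) x).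
Proof. by rewrite /= !xmor_act. Qed.

Definition xcomp g f : xmorphism G L := XMorphism (@xcomp_bd g f) (@xcomp_act g f).

End Morphisms.

Section Inclusion.
Variables (G : crossed_module) (K : subxmod G).

Definition incl : xmorphism K G :=
  @XMorphism K G (val : subgroup_type (stop K) -> top G)
    (val : subgroup_type (sbot K) -> bot G) (fun _ => erefl) (fun _ _ => erefl).
End Inclusion.

Section Projection.
Variables (G : crossed_module) (K : nsubxmod G).

HB.instance Definition _ :=
  isMultiplicative.Build (top G) (top (quotient K)) (proj_top K) (@proj_topM G K).
HB.instance Definition _ :=
  isMultiplicative.Build (bot G) (bot (quotient K)) (proj_bot K) (@proj_botM G K).

Fact xproj_bd x : proj_bot K (bd G x) = bd (quotient K) (proj_top K x).
Proof. by rewrite [RHS]quo_bdE. Qed.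
Fact xproj_act g x :
  proj_top K (act g x) = act (proj_bot K g) (proj_top K x).
Proof. by rewrite [RHS]quo_actE. Qed.

Definition xproj : xmorphism G (quotient K) := XMorphism xproj_bd xproj_act.

Lemma xproj_topK (q : top (quotient K)) : exists x, proj_top K x = q.
Proof. by exists (repr (q : quotient_group (@stop_normal G K))); apply: reprK. Qed.
Lemma xproj_botK (q : bot (quotient K)) : exists x, proj_bot K x = q.
Proof. by exists (repr (q : quotient_group (@sbot_normal G K))); apply: reprK. Qed.

End Projection.

Section XMapsOnto.
Variables (G H : crossed_module).
Implicit Type f : xmorphism G H.

Definition xmaps_onto f (K : subxmod G) (L : subxmod H) :=
  maps_onto (xtop f) (stop K) (stop L) /\ maps_onto (xbot f) (sbot K) (sbot L).

Lemma xmor_displacement f g x :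
  xtop f (displacement g x) = displacement (xbot f g) (xtop f x).
Proof. by rewrite /displacement gmulfM multiplicativeV xmor_act. Qed.

Lemma xmaps_onto_xcomm f (K : nsubxmod G) (L : nsubxmod H) :
  xmaps_onto f (full G) (full H) -> xmaps_onto f K L ->
  xmaps_onto f (xcomm K) (xcomm L).
Proof.
move=> [[_ onto1] onto0] [[KL1 LK1] KL0]; split; last exact: maps_onto_commutator.
have [[_ onto0'] [KL0' LK0]] := (onto0, KL0).
apply: maps_onto_generated => [_ [[k [x [Kk ->]]]|[g [k [Kk ->]]]]|
    _ [[k' [x' [/LK0[k Kk <-] ->]]]|[g' [k' [/LK1[k Kk <-] ->]]]]].
- by rewrite xmor_displacement; left; exists (xbot f k), (xtop f x); auto.
- by rewrite xmor_displacement; right; exists (xbot f g), (xtop f k); auto.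
- have [x _ <-] := onto1 x' isT; rewrite -xmor_displacement.
  by exists (displacement k x) => //; left; exists k, x.
- have [g _ <-] := onto0' g' isT; rewrite -xmor_displacement.
  by exists (displacement g k) => //; right; exists g, k.
Qed.

End XMapsOnto.

Lemma xmaps_onto_comp (G H L : crossed_module) (g : xmorphism H L)
    (f : xmorphism G H) R S T :
  xmaps_onto f R S -> xmaps_onto g S T -> xmaps_onto (xcomp g f) R T.
Proof.
by move=> [RS1 RS0] [ST1 ST0]; split; [apply: maps_onto_comp RS1 ST1|
  apply: maps_onto_comp RS0 ST0].
Qed.

Lemma xmaps_onto_incl (G : crossed_module) (K : subxmod G) :
  xmaps_onto (incl K) (full K) K.
Proof.
by split; split=> [x _|x Kx]; [exact: valP | exists (Sub x Kx); rewrite ?SubK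
  | exact: valP | exists (Sub x Kx); rewrite ?SubK].
Qed.

(** * The derived series inside a fixed crossed module *)

Section SelfCommutator.
Variables (G : crossed_module) (K : subxmod G).

Definition self_comm_top :=
  generated (fun z => exists g x, [/\ g \in sbot K, x \in stop K & z = displacement g x]).
Definition self_comm_bot := commutator (sbot K) (sbot K).

Fact self_comm_bdP x : x \in self_comm_top -> bd G x \in self_comm_bot.
Proof.
apply: generated_morph; first exact: gmulfM.
move=> _ [g [y [Kg Ky ->]]]; rewrite bd_displacement; apply: mem_generated.
by exists g, (bd G y); split=> //; apply: sbdP.
Qed.

Lemma self_comm_act g x :
  g \in sbot K -> x \in self_comm_top -> act g x \in self_comm_top.
Proof.
move=> Kg; apply: generated_morph; first exact: actM.
move=> _ [h [y [Kh Ky ->]]]; rewrite act_displacement; apply: mem_generated.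
exists (g * h * g^-1), (act g y); split=> //; last exact: sactP.
by rewrite gpredF // gpredM.
Qed.

Lemma self_comm_bot_sub g : g \in self_comm_bot -> g \in sbot K.
Proof.
apply: generated_sub => _ [g' [h [Kg Kh ->]]].
by rewrite /comm gpredF // gpredF // gpredM.
Qed.

Lemma self_comm_top_sub x : x \in self_comm_top -> x \in stop K.
Proof.
by apply: generated_sub => _ [g [y [Kg Ky ->]]]; rewrite /displacement gpredF ?sactP.
Qed.

Fact self_comm_actP g x :
  g \in self_comm_bot -> x \in self_comm_top -> act g x \in self_comm_top.
Proof. by move/self_comm_bot_sub; apply: self_comm_act. Qed.

(** The commutator [K,K] as a subcrossed module of G rather than of K: its
    iterates stay inside G, where the terms of a series of G live, whereas the
    carriers of derived G n are nested subtypes. *)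
Definition self_comm : subxmod G := Subxmod self_comm_bdP self_comm_actP.

End SelfCommutator.

Lemma xmaps_onto_self_comm (G H : crossed_module) (f : xmorphism G H)
    (K : subxmod G) (L : subxmod H) :
  xmaps_onto f K L -> xmaps_onto f (self_comm K) (self_comm L).
Proof.
move=> [KL1 KL0]; split; last exact: maps_onto_commutator.
have [[KL1' LK1] [KL0' LK0]] := (KL1, KL0).
apply: maps_onto_generated.
  move=> _ [g [x [Kg Kx ->]]]; rewrite xmor_displacement.
  by exists (xbot f g), (xtop f x); split; auto.
move=> _ [g' [x' [/LK0[g Kg <-] /LK1[x Kx <-] ->]]].
by rewrite -xmor_displacement; exists (displacement g x) => //; exists g, x.
Qed.

Lemma self_comm_full_top (G : crossed_module) x :
  (x \in comm_top G) = (x \in self_comm_top (full G)).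
Proof.
apply/idP/idP; apply: generated_sub => z [g [y]].
  by move=> ->; apply: mem_generated; exists g, y.
by case=> _ _ ->; apply: mem_generated; exists g, y.
Qed.

Definition derived_sub (G : crossed_module) n : subxmod G :=
  iter n (@self_comm G) (full G).

(** The composite of the n inclusions of nested commutators; it transports
    statements about derived G n to the subcrossed module derived_sub G n. *)
Lemma derived_embedding (G : crossed_module) n :
  exists2 f : xmorphism (derived G n) G,
    injective (xtop f) /\ injective (xbot f) &
    xmaps_onto f (full (derived G n)) (derived_sub G n).
Proof.
elim: n => [|n [f [f1 f0] onto_f]].
  exists (@XMorphism G G (idfun : top G -> top G) (idfun : bot G -> bot G)
    (fun _ => erefl) (fun _ _ => erefl)).
    by split; apply: inj_id.
  by split; split=> // x _; exists x.
exists (xcomp f (incl (xcommutator (derived G n)))).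
  by split; apply: inj_comp => //; apply: val_inj.
apply: xmaps_onto_comp (xmaps_onto_incl _) _.
have [[D1 D2] D0] := xmaps_onto_self_comm onto_f; split=> //.
split=> [x|y /D2[x Dx <-]]; first by rewrite self_comm_full_top; apply: D1.
by exists x; rewrite // self_comm_full_top.
Qed.

Lemma trivial_subP (G : crossed_module) (K : subxmod G) :
  trivial K <-> (forall x, x \in stop K -> x = 1) /\ (forall g, g \in sbot K -> g = 1).
Proof.
split=> [[K1 K0]|[K1 K0]]; split=> x.
- by move=> Kx; apply: (congr1 val (K1 (Sub x Kx))).
- by move=> Kx; apply: (congr1 val (K0 (Sub x Kx))).
- by apply: val_inj; apply: K1; apply: valP.
- by apply: val_inj; apply: K0; apply: valP.
Qed.

Lemma trivial_derivedP (G : crossed_module) n :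
  trivial (derived G n) <-> trivial (derived_sub G n).
Proof.
have [f [f1 f0] [[fD1 Df1] [fD0 Df0]]] := derived_embedding G n.
split=> [[D1 D0]|/trivial_subP[D1 D0]].
  apply/trivial_subP; split=> x.
    by move=> /Df1[y _ <-]; rewrite (D1 y) multiplicative1.
  by move=> /Df0[y _ <-]; rewrite (D0 y) multiplicative1.
split=> x.
  by apply: f1; rewrite multiplicative1; apply: D1; apply: fD1.
by apply: f0; rewrite multiplicative1; apply: D0; apply: fD0.
Qed.

(** * Surjections that are injective on the commutator *)

Section Cover.
Variables (E G : crossed_module) (f : xmorphism E G).

Definition commutator_faithful_cover :=
  [/\ xmaps_onto f (full E) (full G),
      forall x, x \in comm_top E -> xtop f x = 1 -> x = 1
    & forall g, g \in comm_bot E -> xbot f g = 1 -> g = 1].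

Hypothesis cf : commutator_faithful_cover.

Lemma trivial_image (K : subxmod E) (L : subxmod G) :
  xmaps_onto f K L -> xsubset K (xcommutator E) -> trivial K <-> trivial L.
Proof.
case: cf => _ ker1 ker0 [[KL1 LK1] [KL0 LK0]] [sK1 sK0].
split=> /trivial_subP[t1 t0]; apply/trivial_subP; split=> x.
- by move=> /LK1[y /t1 -> <-]; rewrite multiplicative1.
- by move=> /LK0[y /t0 -> <-]; rewrite multiplicative1.
- by move=> Kx; apply: ker1; [exact: sK1 | apply: t1; exact: KL1].
- by move=> Kx; apply: ker0; [exact: sK0 | apply: t0; exact: KL0].
Qed.

(** The index starts at Gamma_2, the first term contained in [E,E]; for Gamma_1
    the equivalence fails when E is Abelian, nontrivial, and G is trivial. *)
Lemma trivial_lower_central_image c :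
  trivial (lower_central E c.+2) <-> trivial (lower_central G c.+2).
Proof.
have [onto_f _ _] := cf.
apply: trivial_image.
  rewrite /lower_central; elim: c.+1 => //= n IHn; exact: xmaps_onto_xcomm.
split=> x; apply: generated_sub.
  by move=> _ [[k [y [_ ->]]]|[g [k [_ ->]]]]; apply: mem_generated; eexists; eexists.
by move=> _ [g [h [_ _ ->]]]; apply: mem_generated; exists g, h.
Qed.

Lemma trivial_derived_image n :
  trivial (derived E n.+1) <-> trivial (derived G n.+1).
Proof.
have [onto_f _ _] := cf.
rewrite !trivial_derivedP; apply: trivial_image.
  elim: n.+1 => //= m IHm; exact: xmaps_onto_self_comm.
split=> x; apply: generated_sub.
  by move=> _ [g [y [_ _ ->]]]; apply: mem_generated; exists g, y.
by move=> _ [g [h [_ _ ->]]]; apply: mem_generated; exists g, h.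
Qed.

End Cover.

(** * The common cover of two isoclinic crossed modules *)

Section PairGroup.
Variables G H : groupType.

Definition pair_mul (p q : G * H) := (p.1 * q.1, p.2 * q.2).
Definition pair_one : G * H := (1, 1).
Definition pair_inv (p : G * H) := (p.1^-1, p.2^-1).

Fact pair_mulA : associative pair_mul.
Proof. by move=> p q r; rewrite /pair_mul /= !mulgA. Qed.
Fact pair_mul1 : left_id pair_one pair_mul.
Proof. by case=> x y; rewrite /pair_mul /= !mul1g. Qed.
Fact pair_mulr1 : right_id pair_one pair_mul.
Proof. by case=> x y; rewrite /pair_mul /= !mulg1. Qed.
Fact pair_mulV : left_inverse pair_one pair_inv pair_mul.
Proof. by case=> x y; rewrite /pair_mul /= !mulVg. Qed.
Fact pair_mulrV : right_inverse pair_one pair_inv pair_mul.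
Proof. by case=> x y; rewrite /pair_mul /= !mulgV. Qed.

HB.instance Definition _ := isGroup.Build (G * H)%type
  pair_mulA pair_mul1 pair_mulr1 pair_mulV pair_mulrV.

HB.instance Definition _ :=
  isMultiplicative.Build (G * H)%type G fst (fun _ _ => erefl).
HB.instance Definition _ :=
  isMultiplicative.Build (G * H)%type H snd (fun _ _ => erefl).

End PairGroup.

Section PairCrossedModule.
Variables G H : crossed_module.
Local Notation P1 := (top G * top H)%type.
Local Notation P0 := (bot G * bot H)%type.

Definition pair_bd (p : P1) : P0 := (bd G p.1, bd H p.2).
Definition pair_act (g : P0) (p : P1) : P1 := (act g.1 p.1, act g.2 p.2).

Fact pair_bdM : {morph pair_bd : p q / p * q}.
Proof. by move=> p q; rewrite /pair_bd /= !gmulfM. Qed.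
HB.instance Definition _ := isMultiplicative.Build P1 P0 pair_bd pair_bdM.

Fact pair_act1 p : pair_act 1 p = p.
Proof. by case: p => x y; rewrite /pair_act /= !act1. Qed.
Fact pair_actA g h p : pair_act (g * h) p = pair_act g (pair_act h p).
Proof. by rewrite /pair_act /= !actA. Qed.
Fact pair_actM g p q : pair_act g (p * q) = pair_act g p * pair_act g q.
Proof. by rewrite /pair_act /= !actM. Qed.
Fact pair_bd_act g p : pair_bd (pair_act g p) = g * pair_bd p * g^-1.
Proof. by rewrite /pair_bd /= !bd_act. Qed.
Fact pair_peiffer p q : pair_act (pair_bd p) q = p * q * p^-1.
Proof. by rewrite /pair_act /= !peiffer. Qed.

Definition pair_xmod : crossed_module :=
  CrossedModule pair_act1 pair_actA pair_actM pair_bd_act pair_peiffer.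

Definition xfst : xmorphism pair_xmod G :=
  @XMorphism pair_xmod G (fst : P1 -> top G) (fst : P0 -> bot G)
    (fun _ => erefl) (fun _ _ => erefl).
Definition xsnd : xmorphism pair_xmod H :=
  @XMorphism pair_xmod H (snd : P1 -> top H) (snd : P0 -> bot H)
    (fun _ => erefl) (fun _ _ => erefl).

End PairCrossedModule.

Fact equalizer_closed (G H : groupType) (a b : {multiplicative G -> H}) :
  group_closed (fun x => a x == b x).
Proof.
split=> [|x y /eqP abx /eqP aby]; apply/eqP; first by rewrite !multiplicative1.
by rewrite !gmulfM !multiplicativeV abx aby.
Qed.

Section Equalizer.
Variables (G H : crossed_module) (a b : xmorphism G H).

Local Notation eq_top := (mk_subgroup (equalizer_closed (xtop a) (xtop b))).
Local Notation eq_bot := (mk_subgroup (equalizer_closed (xbot a) (xbot b))).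

Fact equalizer_bdP x : x \in eq_top -> bd G x \in eq_bot.
Proof. by move=> /eqP abx; apply/eqP; rewrite !xmor_bd abx. Qed.

Fact equalizer_actP g x : g \in eq_bot -> x \in eq_top -> act g x \in eq_top.
Proof. by move=> /eqP abg /eqP abx; apply/eqP; rewrite !xmor_act abg abx. Qed.

Definition equalizer : subxmod G := Subxmod equalizer_bdP equalizer_actP.

End Equalizer.

(** The pairs (i u, k u) form a subgroup, so membership of (a p, b p) in it need
    only be checked on generators. *)
Lemma generated_related (P U G H : groupType) (A : P -> Prop)
    (a : {multiplicative P -> G}) (b : {multiplicative P -> H})
    (i : {multiplicative U -> G}) (k : {multiplicative U -> H}) :
  (forall p, A p -> exists u, i u = a p /\ k u = b p) ->
  forall p, p \in generated A -> exists u, i u = a p /\ k u = b p.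
Proof.
move=> AR; pose I : {pred P} := fun p => `[< exists u, i u = a p /\ k u = b p >].
have gI : group_closed I.
  split=> [|p q /asboolP[u [iu ku]] /asboolP[v [iv kv]]]; apply/asboolP.
    by exists 1; rewrite !multiplicative1.
  by exists (u / v); rewrite !gmulfM !multiplicativeV iu iv ku kv.
move=> p Ap; apply/asboolP.
by apply: (generated_sub (S := mk_subgroup gI)) Ap => q /AR Rq; apply/asboolP.
Qed.

(** The cover is the fibre product over G/Z(G) = H/Z(H).  The isomorphism xi
    between the commutators serves only to show that an element of [E,E] is
    determined by either of its components. *)
Lemma isoclinic_common_cover (G H : crossed_module) : isoclinic G H ->
  exists (E : crossed_module) (f : xmorphism E G) (g : xmorphism E H),
    commutator_faithful_cover f /\ commutator_faithful_cover g.
Proof.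
move=> [eta [xi [[[eta1' e1K eK1] [eta0' e0K eK0]] [iso1 iso0] c1P c0P]]].
pose pG := xproj (xcenter G); pose pH := xproj (xcenter H).
pose E := equalizer (xcomp eta (xcomp pG (xfst G H))) (xcomp pH (xsnd G H)).
have E1P (x : top G) (y : top H) :
    xtop eta (proj_top _ x) = proj_top _ y -> (x, y) \in stop E.
  by move=> exy; apply/eqP.
have E0P (x : bot G) (y : bot H) :
    xbot eta (proj_bot _ x) = proj_bot _ y -> (x, y) \in sbot E.
  by move=> exy; apply/eqP.
have rel1 (p : top E) : p \in comm_top E ->
    exists u, val u = (val p).1 /\ val (xtop xi u) = (val p).2.
  apply: (generated_related (a := fst \o val) (b := snd \o val)
    (i := val) (k := val \o xtop xi)) => _ [g [x ->]].
  (* The compatibility of xi and eta with c1 makes this element a witness. *)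
  exists (c1 (proj_top _ (val x).1) (proj_bot _ (val g).1)).
  split; first exact: c1E.
  rewrite /= c1P.
  have /eqP /= -> := valP x; have /eqP /= -> := valP g.
  exact: c1E.
have rel0 (p : bot E) : p \in comm_bot E ->
    exists u, val u = (val p).1 /\ val (xbot xi u) = (val p).2.
  apply: (generated_related (a := fst \o val) (b := snd \o val)
    (i := val) (k := val \o xbot xi)) => _ [g [h [_ _ ->]]].
  exists (c0 (proj_bot _ (val g).1) (proj_bot _ (val h).1)).
  split; first exact: c0E.
  rewrite /= c0P.
  have /eqP /= -> := valP g; have /eqP /= -> := valP h.
  exact: c0E.
have ker1 (p : top E) : p \in comm_top E ->
    (val p).1 = 1 \/ (val p).2 = 1 -> p = 1.
  move=> /rel1[u [up xup]] p1; have u1 : u = 1.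
    case: p1 => p1; first by apply: val_inj; rewrite up p1.
    by apply: (bij_inj iso1); rewrite multiplicative1; apply: val_inj; rewrite xup p1.
  apply: val_inj; apply: injective_projections;
    by rewrite -?up -?xup u1 ?multiplicative1.
have ker0 (p : bot E) : p \in comm_bot E ->
    (val p).1 = 1 \/ (val p).2 = 1 -> p = 1.
  move=> /rel0[u [up xup]] p1; have u1 : u = 1.
    case: p1 => p1; first by apply: val_inj; rewrite up p1.
    by apply: (bij_inj iso0); rewrite multiplicative1; apply: val_inj; rewrite xup p1.
  apply: val_inj; apply: injective_projections;
    by rewrite -?up -?xup u1 ?multiplicative1.
exists E, (xcomp (xfst G H) (incl E)), (xcomp (xsnd G H) (incl E)).
split; split.
- split; split=> // x _.
    have [y yP] := xproj_topK (xtop eta (proj_top _ x)).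
    by exists (Sub (x, y) (E1P _ _ (esym yP))); rewrite //= SubK.
  have [y yP] := xproj_botK (xbot eta (proj_bot _ x)).
  by exists (Sub (x, y) (E0P _ _ (esym yP))); rewrite //= SubK.
- by move=> p cp p1; apply: ker1 => //; left.
- by move=> p cp p1; apply: ker0 => //; left.
- split; split=> // y _.
    have [x xP] := xproj_topK (eta1' (proj_top _ y)).
    have exy : xtop eta (proj_top _ x) = proj_top _ y by rewrite xP eK1.
    by exists (Sub (x, y) (E1P _ _ exy)); rewrite //= SubK.
  have [x xP] := xproj_botK (eta0' (proj_bot _ y)).
  have exy : xbot eta (proj_bot _ x) = proj_bot _ y by rewrite xP eK0.
  by exists (Sub (x, y) (E0P _ _ exy)); rewrite //= SubK.
- by move=> p cp p1; apply: ker1 => //; right.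
- by move=> p cp p1; apply: ker0 => //; right.
Qed.

(** * Central and Abelian factors *)

Lemma normal_coset_sym (G : groupType) (N : groupClosed G) x y :
  normal N -> (x^-1 * y \in N) = (y * x^-1 \in N).
Proof.
move=> nN; apply/idP/idP => [/(nN x)|/(normalV nN x)].
  by rewrite mulVKg.
by rewrite mulgA mulgVK.
Qed.

Section QuotientCenter.
Variables (G : crossed_module) (K : nsubxmod G).

Lemma proj_fixedP x :
  proj_top K x \in fixed_points (quotient K) <->
  forall g : bot G, displacement g x \in stop K.
Proof.
split=> [/asboolP fx g|Kx].
  have := fx (proj_bot K g); rewrite -xproj_act => /esym/coset_eqP.
  by rewrite normal_coset_sym //; apply: stop_normal.
apply/asboolP => q; have [g <-] := xproj_botK q.
rewrite -xproj_act; apply/esym/coset_eqP.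
by rewrite normal_coset_sym ?Kx //; apply: stop_normal.
Qed.

Lemma proj_centerP g :
  proj_bot K g \in center_bot (quotient K) <->
  (forall x : top G, displacement g x \in stop K) /\
  (forall h, comm g h \in sbot K).
Proof.
have commE h : (h * g)^-1 * (g * h) \in sbot K = (comm g h \in sbot K).
  rewrite normal_coset_sym; first by rewrite /comm invgM !mulgA.
  exact: sbot_normal.
split=> [/andP[/asboolP sg /asboolP cg]|[Kg1 Kg0]].
  split=> [x|h].
    have := sg (proj_top K x); rewrite -xproj_act => /esym/coset_eqP.
    by rewrite normal_coset_sym //; apply: stop_normal.
  have := cg (proj_bot K h); rewrite -!proj_botM => /esym/coset_eqP.
  by rewrite commE.
apply/andP; split; apply/asboolP => q.
  have [x <-] := xproj_topK q; rewrite -xproj_act; apply/esym/coset_eqP.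
  by rewrite normal_coset_sym ?Kg1 //; apply: stop_normal.
have [h <-] := xproj_botK q; rewrite -!proj_botM.
by apply/esym/coset_eqP; rewrite commE.
Qed.

Lemma xabelian_quotientP :
  xabelian (quotient K) <-> xsubset (xcommutator G) K.
Proof.
split=> [[ab1 ab0]|[cK1 cK0]].
  split=> x; apply: generated_sub.
    by move=> _ [g [y ->]]; apply: (proj_fixedP y).1; apply: ab1.
  by move=> _ [g [h [_ _ ->]]]; apply: ((proj_centerP g).1 _).2; apply: ab0.
split=> q _.
  have [x <-] := xproj_topK q; apply/proj_fixedP => g.
  by apply: cK1; apply: mem_generated; exists g, x.
have [g <-] := xproj_botK q; apply/proj_centerP; split=> [x|h].
  by apply: cK1; apply: mem_generated; exists g, x.
by apply: cK0; apply: mem_generated; exists g, h.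
Qed.

Lemma image_central_quotientP (L : subxmod G) :
  xsubset (image_quotient K L) (xcenter (quotient K)) <->
  [/\ forall g x, x \in stop L -> displacement g x \in stop K,
      forall g (x : top G), g \in sbot L -> displacement g x \in stop K
    & forall g h, g \in sbot L -> comm g h \in sbot K].
Proof.
split=> [[cL1 cL0]|[cL1 cL01 cL0]].
  have LZ1 x : x \in stop L -> proj_top K x \in fixed_points (quotient K).
    by move=> Lx; apply: cL1; apply/asboolP; exists x.
  have LZ0 g : g \in sbot L -> proj_bot K g \in center_bot (quotient K).
    by move=> Lg; apply: cL0; apply/asboolP; exists g.
  by split=> [g x /LZ1/proj_fixedP|g x /LZ0/proj_centerP[]|g h /LZ0/proj_centerP[]].
split=> _ /asboolP[x Lx ->].
  by apply/proj_fixedP => g; apply: cL1.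
by apply/proj_centerP; split=> [y|h]; [apply: cL01 | apply: cL0].
Qed.

End QuotientCenter.

Lemma trivial_sub (G : crossed_module) (K L : subxmod G) :
  xsubset K L -> trivial L -> trivial K.
Proof.
move=> [KL1 KL0] /trivial_subP[L1 L0]; apply/trivial_subP.
by split=> x; [move/KL1/L1 | move/KL0/L0].
Qed.

Lemma normal_restrict (G : crossed_module) (K L : subxmod G) :
  xnormal K -> xnormal (restrict K L).
Proof.
move=> [nK0 K_act K_disp]; split=> [g n|g k|k x] Kn.
- exact: nK0 Kn.
- exact: K_act Kn.
- exact: K_disp Kn.
Qed.

(** * Nilpotency through the lower central series *)

Section Nilpotent.
Variable G : crossed_module.

Lemma xcomm_sub (K : nsubxmod G) : xsubset (xcomm K) K.
Proof.
have [nK0 K_act K_disp] := nsubP K.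
split=> x; apply: generated_sub.
  move=> _ [[k [y [Kk ->]]]|[g [k [Kk ->]]]]; first exact: K_disp.
  by rewrite gpredF //; apply: K_act.
move=> _ [k [h [Kk _ ->]]]; rewrite /comm -!mulgA gpredM // mulgA nK0 //.
by rewrite gpredV.
Qed.

Lemma central_factor_sub (K L : subxmod G) (M : nsubxmod G) :
  central_factor L K -> xsubset M L -> xsubset (xcomm M) K.
Proof.
move=> [nK /image_central_quotientP[c1 c01 c0]] [ML1 ML0].
split=> x; apply: generated_sub.
  by move=> _ [[k [y [Mk ->]]]|[g [k [Mk ->]]]]; [apply: c01; auto|apply: c1; auto].
by move=> _ [k [h [Mk _ ->]]]; apply: c0; auto.
Qed.

Lemma central_factor_xcomm (K : nsubxmod G) : central_factor K (xcomm K).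
Proof.
exists (nsubP (xcomm K)); apply/image_central_quotientP.
split=> [g x Kx|g x Kg|g h Kg]; apply: mem_generated.
- by right; exists g, x.
- by left; exists g, x.
- by exists g, h.
Qed.

(** A central series K^0, ..., K^n satisfies Gamma_(j+1) <= K^(n-j); conversely
    the lower central series, read backwards, is a central series. *)
Lemma nilpotentP : nilpotent G <-> exists c, trivial (lower_central G c.+1).
Proof.
pose Gamma j := lower_central G j.+1; split=> [[s cs]|[c tc]].
  exists (len s); apply: (trivial_sub _ (term_first s)).
  suff sub j : (j <= len s)%N -> xsubset (Gamma j) (term s (len s - j)).
    by have := sub _ (leqnn _); rewrite subnn.
  elim: j => [_|j IHj lt_j]; first by rewrite subn0; apply: term_last.
  change (Gamma j.+1) with (xcomm (Gamma j)).
  apply: (central_factor_sub _ (IHj (ltnW lt_j))).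
  have lt_i : (len s - j.+1 < len s)%N by rewrite subnSK // leq_subr.
  by have := cs (Ordinal lt_i); rewrite /= subnSK.
(* Gamma j is shifted so that Gamma 0 = G: the term of index i, Gamma (c - i),
   runs from the trivial Gamma c up to G. *)
pose t i : subxmod G := Gamma (c - i)%N.
have t_first : trivial (t 0) by rewrite /t subn0.
have t_last : xsubset (full G) (t c) by rewrite /t subnn.
have tE i : (i < c)%N -> t i = xcomm (Gamma (c - i.+1)).
  by move=> lt_ic; rewrite /t -subnSK.
have t_sub i : (i < c)%N -> xsubset (t i) (t i.+1).
  by move=> /tE ->; apply: xcomm_sub.
have t_normal i : (i < c)%N -> xnormal (restrict (t i) (t i.+1)).
  by move=> _; apply/normal_restrict/nsubP.
exists (Series t_first t_last t_sub t_normal) => -[i lt_ic] /=.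
by rewrite (tE i) //; apply: central_factor_xcomm.
Qed.

End Nilpotent.

(** * Solvability through the derived series *)

Section Solvable.
Variable G : crossed_module.

Lemma self_comm_sub (K : subxmod G) : xsubset (self_comm K) K.
Proof. by split=> x; [apply: self_comm_top_sub | apply: self_comm_bot_sub]. Qed.

Lemma self_comm_mono (K L : subxmod G) :
  xsubset K L -> xsubset (self_comm K) (self_comm L).
Proof.
move=> [KL1 KL0]; split=> x; apply: generated_sub.
  move=> _ [g [y [Kg Ky ->]]]; apply: mem_generated.
  by exists g, y; split; auto.
move=> _ [g [h [Kg Kh ->]]]; apply: mem_generated.
by exists g, h; split; auto.
Qed.

(** Each derived term is only asserted to be normal in the preceding one, as a
    series demands; conjugates of n differ from n by a commutator. *)
Lemma self_comm_restrict_normal (K : subxmod G) :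
  xnormal (restrict (self_comm K) K).
Proof.
split=> [g n|g k|k x] Kn.
- change (val g * val n * (val g)^-1 \in self_comm_bot K).
  have -> : val g * val n * (val g)^-1 = comm (val g) (val n) * val n.
    by rewrite /comm mulgVK.
  rewrite gpredM //; apply: mem_generated; exists (val g), (val n).
  by split=> //; apply: valP.
- exact: (self_comm_act (valP g) Kn).
- apply: mem_generated; exists (val k), (val x).
  by split=> //; apply: valP.
Qed.

Lemma abelian_factorP (K L : subxmod G) (nKL : xnormal (restrict K L)) :
  xabelian (quotient (NSubxmod nKL)) <-> xsubset (self_comm L) K.
Proof.
rewrite xabelian_quotientP /=; split=> [[cK1 cK0]|[cK1 cK0]].
  split=> x; apply: generated_sub.
    move=> _ [g [y [Lg Ly ->]]].
    apply: (cK1 (displacement (Sub g Lg : bot L) (Sub y Ly))).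
    by apply: mem_generated; exists (Sub g Lg : bot L), (Sub y Ly).
  move=> _ [g [h [Lg Lh ->]]].
  apply: (cK0 (comm (Sub g Lg : bot L) (Sub h Lh))).
  by apply: mem_generated; exists (Sub g Lg : bot L), (Sub h Lh).
split=> x; apply: generated_sub.
  move=> _ [g [y ->]]; apply: cK1; apply: mem_generated; exists (val g), (val y).
  by split=> //; apply: valP.
move=> _ [g [h [_ _ ->]]]; apply: cK0; apply: mem_generated; exists (val g), (val h).
by split=> //; apply: valP.
Qed.

(** As for nilpotency: the Abelian factor K^(i+1)/K^i forces [K^(i+1),K^(i+1)]
    into K^i, so the j-th derived term lies in K^(n-j). *)
Lemma solvableP : solvable G <-> exists n, trivial (derived G n).
Proof.
split=> [[s ab]|[n]].
  exists (len s); apply/trivial_derivedP; apply: (trivial_sub _ (term_first s)).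
  suff sub j : (j <= len s)%N -> xsubset (derived_sub G j) (term s (len s - j)).
    by have := sub _ (leqnn _); rewrite subnn.
  elim: j => [_|j IHj lt_j]; first by rewrite subn0; apply: term_last.
  have lt_i : (len s - j.+1 < len s)%N by rewrite subnSK // leq_subr.
  have /abelian_factorP := ab (Ordinal lt_i); rewrite /= subnSK // => -[c1 c0].
  have [D1 D0] := self_comm_mono (IHj (ltnW lt_j)).
  by split=> x; [move/D1/c1 | move/D0/c0].
move=> /trivial_derivedP tn; pose t i := derived_sub G (n - i).
have t_first : trivial (t 0) by rewrite /t subn0.
have t_last : xsubset (full G) (t n) by rewrite /t subnn.
have tE i : (i < n)%N -> t i = self_comm (t i.+1).
  by move=> lt_in; rewrite /t -subnSK.
have t_sub i : (i < n)%N -> xsubset (t i) (t i.+1).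
  by move=> /tE ->; apply: self_comm_sub.
have t_normal i : (i < n)%N -> xnormal (restrict (t i) (t i.+1)).
  by move=> /tE ->; apply: self_comm_restrict_normal.
exists (Series t_first t_last t_sub t_normal) => -[i lt_in].
by apply/abelian_factorP; split=> x; rewrite /= (tE i).
Qed.

End Solvable.

(** * Invariance under isoclinism *)

Lemma trivial_lower_centralS (G : crossed_module) c :
  trivial (lower_central G c.+1) -> trivial (lower_central G c.+2).
Proof. exact: (trivial_sub (xcomm_sub (lower_central G c.+1))). Qed.

Lemma trivial_derivedS (G : crossed_module) n :
  trivial (derived G n) -> trivial (derived G n.+1).
Proof.
by rewrite !trivial_derivedP; apply: (trivial_sub (self_comm_sub (derived_sub G n))).
Qed.

Lemma trivial_full (G : crossed_module) : trivial (full G) <-> trivial G.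
Proof.
rewrite trivial_subP; split=> -[t1 t0]; split=> // x; [exact: t1 | exact: t0].
Qed.

Lemma isoclinic_lower_central (G H : crossed_module) c : isoclinic G H ->
  trivial (lower_central G c.+2) <-> trivial (lower_central H c.+2).
Proof.
move=> /isoclinic_common_cover[E [f [g [cf cg]]]].
by rewrite -(trivial_lower_central_image cf) (trivial_lower_central_image cg).
Qed.

Lemma isoclinic_derived (G H : crossed_module) n : isoclinic G H ->
  trivial (derived G n.+1) <-> trivial (derived H n.+1).
Proof.
move=> /isoclinic_common_cover[E [f [g [cf cg]]]].
by rewrite -(trivial_derived_image cf) (trivial_derived_image cg).
Qed.

Lemma common_least (P Q : nat -> Prop) :
  (forall n, P n <-> Q n) -> (exists n, P n) ->
  exists n, (P n /\ forall m, P m -> (n <= m)%N) /\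
            (Q n /\ forall m, Q m -> (n <= m)%N).
Proof.
move=> PQ [n0 Pn0]; have exP : exists n, `[< P n >] by exists n0; apply/asboolP.
case: (ex_minnP exP) => n /asboolP Pn min_n; exists n.
split; split; rewrite -?PQ // => m; last rewrite -PQ; by move=> Pm; apply/min_n/asboolP.
Qed.

Theorem proposition34 (G H : crossed_module) (iGH : isoclinic G H) :
  ((nilpotent G <-> nilpotent H) /\ (solvable G <-> solvable H)) /\
  (~ trivial G -> ~ trivial H ->
    (nilpotent G -> nilpotent H ->
      exists c : nat, nilpotency_class G c /\ nilpotency_class H c) /\
    (solvable G -> solvable H ->
      exists n : nat, derived_length G n /\ derived_length H n)).
Proof.
split; first split.
(* The index is raised by one so that the term lies in the commutator. *)
- rewrite !nilpotentP; split=> -[c /trivial_lower_centralS tc]; exists c.+1;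
    exact/(isoclinic_lower_central c iGH).
- rewrite !solvableP; split=> -[n /trivial_derivedS tn]; exists n.+1;
    exact/(isoclinic_derived n iGH).
move=> ntG ntH; split=> [/nilpotentP exc _|/solvableP exn _].
  apply: common_least exc => -[|c]; last exact: isoclinic_lower_central.
  by split=> /trivial_full.
apply: common_least exn => -[|n]; last exact: isoclinic_derived.
by split.
Qed.
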